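(* Let $(P_n(x))_{n\in\mathbb{N}_0}\subseteq\mathbb{R}[x]$ be a sequence given by $P_0(x)=1$, $P_1(x)=x$, $xP_n(x)=a_nP_{n+1}(x)+c_nP_{n-1}(x)$ $(n\in\mathbb{N})$ with $(c_n)_{n\in\mathbb{N}}\subseteq(0,1)$ and $a_n=1-c_n$, and assume that $(P_n(x))_{n\in\mathbb{N}_0}$ satisfies nonnegative linearization of products. If $(c_n)_{n\in\mathbb{N}}$ is convergent, then $h(n)\geq 2$ for all $n\in\mathbb{N}$.
   Context: $\mathbb{N}=\{1,2,3,\ldots\}$ and $\mathbb{N}_0=\mathbb{N}\cup\{0\}$. A sequence $(P_n(x))_{n\in\mathbb{N}_0}$ given by such a recurrence satisfies $\deg P_n=n$ and $P_n(1)=1$ for all $n$, and it is orthogonal with respect to a unique probability Borel measure $\mu$ on $\mathbb{R}$, meaning that $\int_{\mathbb{R}}P_m(x)P_n(x)\,\mathrm{d}\mu(x)\neq 0\Leftrightarrow m=n$. Nonnegative linearization of products means that in the (unique) expansions $P_m(x)P_n(x)=\sum_{k=0}^{m+n}g(m,n;k)P_k(x)$ all coefficients $g(m,n;k)$ $(m,n,k\in\mathbb{N}_0)$ are nonnegative. The Haar function is $h(n):=1/g(n,n;0)=1/\int_{\mathbb{R}}P_n^2(x)\,\mathrm{d}\mu(x)$; equivalently, $h(0)=1$ and $h(n)=\prod_{k=1}^n a_{k-1}/c_k$ for $n\in\mathbb{N}$, where $a_0:=1$. *)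

(* Defs.v *)
From HB Require Import structures.
From mathcomp Require Import all_boot all_order all_algebra.
From mathcomp Require Import all_classical all_reals all_analysis.
Set Implicit Arguments.
Unset Strict Implicit.
Unset Printing Implicit Defensive.
Import Order.TTheory GRing.Theory Num.Theory.
Import numFieldNormedType.Exports.
Local Open Scope ring_scope.

(* The sequence (c_n) is indexed by n >= 1: the value [c 0] is never used. *)
Definition three_term_recurrence (R : realType) (c : nat -> R)
    (P : nat -> {poly R}) : Prop :=
  [/\ P 0%N = 1,
      P 1%N = 'X
    & forall n : nat, (1 <= n)%N ->
        'X * P n = (1 - c n) *: P n.+1 + c n *: P n.-1].

(* As deg P_n = n, the family (P_n) is a basis of R[x], so this relation has
   exactly one solution g; coefficients outside the range k <= m + n are 0. *)
Definition linearization_coefficients (R : realType) (P : nat -> {poly R})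
    (g : nat -> nat -> nat -> R) : Prop :=
  forall m n : nat,
    P m * P n = \sum_(0 <= k < (m + n).+1) g m n k *: P k
    /\ forall k : nat, (m + n < k)%N -> g m n k = 0.

Definition haar (R : realType) (g : nat -> nat -> nat -> R) (n : nat) : R :=
  1 / g n n 0%N.

(* Main.v *)
Require Import Defs.
From HB Require Import structures.
From mathcomp Require Import all_boot all_order all_algebra.
From mathcomp Require Import all_classical all_reals all_analysis.
From mathcomp Require Import ring lra.
Set Implicit Arguments.
Unset Strict Implicit.
Unset Printing Implicit Defensive.
Import Order.TTheory GRing.Theory Num.Theory.
Import numFieldNormedType.Exports.
Local Open Scope classical_set_scope.
Local Open Scope ring_scope.

(* Let a_n = 1 - c_n and b = sqrt (lim a_n c_n). Nonnegativity of the
   coefficients g(2, m; m) for large m forces c_1 <= 2 b^2, so b > 0.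

   After passing to the orthonormal polynomials, the Jacobi matrix of (P_n)
   tends to a Toeplitz matrix; hence the rescaled coefficients g(n, m; m + j)
   tend, as m -> oo, to the coefficients of P_n in the Chebyshev basis
   T_j(x / 2b), up to a factor 1/2 for j > 0. These Chebyshev coefficients
   E_0, E_1, ... are therefore nonnegative, and for the arcsine measure nu of
   [-2b, 2b] one gets
     1 / h(n) = g(n, n; 0) <= int P_n^2 dnu = E_0^2 + (1/2) sum_(j > 0) E_j^2.
   Since T_j(1 / 2b) >= 1, P_n(1) = 1 gives sum_j E_j <= 1. The right-hand side
   is then at most 1/2 as soon as E_0 <= sum_(j > 0) E_j, for which it suffices
   that P_n takes a value <= 0 somewhere on [-2b, 2b].

   To find such a point, let w be the supremum of the x >= 0 at which some P_k
   is <= 0. By linearization P_n(w)^2 >= g(n, n; 0), so the orthonormal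
   polynomials are all >= 1 at w. If w > 2b, the recurrence would make them
   eventually increasing, and this would persist slightly to the left of w,
   contradicting the choice of w. So w <= 2b, whereas P_n is <= 0 somewhere on
   [0, w] by interlacing. *)

(** * Coordinates and integration for a basis given by a three-term recurrence *)

Section JacobiFunctional.
Context {F : fieldType} (a c : nat -> F).
Implicit Types (f h : {poly F}) (i k n : nat).

(** Coordinate of ['X^i] along [Q k], computed without [Q]: the recursion in [i] is multiplication
    by ['X] acting on coordinate vectors. *)
Fixpoint jmoment (i k : nat) : F :=
  if i is i'.+1 then
    (if k is k'.+1 then a k' * jmoment i' k' else 0) + c k.+1 * jmoment i' k.+1
  else (k == 0%N)%:R.

(* [jcoord k f] is the coordinate of [f] along [Q k], for the basis [Q] with
   [Q 0 = 1] and [X Q_k = a_k Q_(k+1) + c_k Q_(k-1)]; in particular [jcoord 0]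
   is integration against the orthogonality measure of [Q]. *)
Definition jcoord (k : nat) (f : {poly F}) : F :=
  \sum_(i < size f) f`_i * jmoment i k.

Lemma jcoord_widen N k f : (size f <= N)%N ->
  jcoord k f = \sum_(i < N) f`_i * jmoment i k.
Proof.
move=> fN; rewrite /jcoord (big_ord_widen N (fun i => f`_i * jmoment i k)) //.
rewrite big_mkcond; apply: eq_bigr => i _; case: ltnP => // fi.
by rewrite nth_default ?mul0r.
Qed.

Lemma jcoordD k f h : jcoord k (f + h) = jcoord k f + jcoord k h.
Proof.
have fhN := size_polyD f h; set N := maxn _ _ in fhN.
rewrite (jcoord_widen _ fhN) (@jcoord_widen N k f) ?leq_maxl//.
rewrite (@jcoord_widen N k h) ?leq_maxr// -big_split/=.
by apply: eq_bigr => i _; rewrite coefD mulrDl.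
Qed.

Lemma jcoordZ k x f : jcoord k (x *: f) = x * jcoord k f.
Proof.
rewrite (jcoord_widen _ (size_scale_leq x f)) mulr_sumr.
by apply: eq_bigr => i _; rewrite coefZ mulrA.
Qed.

Lemma jcoord_zero k : jcoord k 0 = 0.
Proof. by rewrite /jcoord size_poly0 big_ord0. Qed.

Lemma jcoordB k f h : jcoord k (f - h) = jcoord k f - jcoord k h.
Proof. by rewrite -scaleN1r jcoordD jcoordZ mulN1r. Qed.

Lemma jcoord_sum k (I : Type) (r : seq I) (p : pred I) (fI : I -> {poly F}) :
  jcoord k (\sum_(i <- r | p i) fI i) = \sum_(i <- r | p i) jcoord k (fI i).
Proof. exact: (big_morph _ (jcoordD k) (jcoord_zero k)). Qed.

Lemma jcoord1 k : jcoord k 1 = (k == 0%N)%:R.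
Proof. by rewrite /jcoord size_poly1 big_ord1 coef1 mul1r. Qed.

Lemma jcoordC k x : jcoord k x%:P = x * (k == 0%N)%:R.
Proof. by rewrite -alg_polyC jcoordZ jcoord1. Qed.

Lemma jcoordX0 f : jcoord 0%N ('X * f) = c 1%N * jcoord 1%N f.
Proof.
rewrite (@jcoord_widen (size f).+1); last first.
  by rewrite (leq_trans (size_polyMleq _ _))// size_polyX.
rewrite big_ord_recl coefXM mul0r add0r mulr_sumr.
by apply: eq_bigr => i _; rewrite coefXM /= add0r mulrCA.
Qed.

Lemma jcoordXS k f :
  jcoord k.+1 ('X * f) = a k * jcoord k f + c k.+2 * jcoord k.+2 f.
Proof.
rewrite (@jcoord_widen (size f).+1); last first.
  by rewrite (leq_trans (size_polyMleq _ _))// size_polyX.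
rewrite big_ord_recl coefXM mul0r add0r !mulr_sumr -big_split/=.
by apply: eq_bigr => i _; rewrite coefXM /=; ring.
Qed.

Lemma jcoord_size k f : (size f <= k)%N -> jcoord k f = 0.
Proof.
elim/poly_ind: f k => [|f x IH] k; first by rewrite jcoord_zero.
have [->|f0] := eqVneq f 0.
  rewrite mul0r add0r size_polyC; have [->|x0] := eqVneq x 0.
    by rewrite jcoord_zero.
  by case: k => // k _; rewrite jcoordC mulr0.
rewrite size_MXaddC (negbTE f0)/=; case: k => // k fk.
rewrite jcoordD jcoordC mulr0 addr0.
by rewrite mulrC jcoordXS !IH ?mulr0 ?addr0 //; do 2!apply: leqW.
Qed.

(** Solving the recurrence for its leading term gives an explicit basis; with Chebyshev coefficients
    it supplies [tau] in the final theorem. *)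
Fixpoint jpoly (n : nat) : {poly F} :=
  if n is n'.+1 then
    (a n')^-1 *:
      ('X * jpoly n' - c n' *: (if n' is n''.+1 then jpoly n'' else 0))
  else 1.

Lemma jpolyX n : a n != 0 -> c 0%N = 0 ->
  'X * jpoly n = a n *: jpoly n.+1 + c n *: jpoly n.-1.
Proof.
move=> an0 c0 /=; rewrite scalerA mulfV// scale1r.
by case: n {an0} => [|n] /=; rewrite ?c0 ?scale0r ?subr0 ?addr0 ?subrK.
Qed.

Context (Q : nat -> {poly F}).
Hypothesis a_neq0 : forall n, a n != 0.
Hypothesis c0 : c 0%N = 0.
Hypothesis Q0 : Q 0%N = 1.
Hypothesis QX : forall n, 'X * Q n = a n *: Q n.+1 + c n *: Q n.-1.

(** Two-step induction in which the predecessor of [0] is [0], as in the recurrence at index [0],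
    where [c 0 = 0] kills the last term. *)
Lemma jacobi_ind (A : nat -> Prop) :
  A 0%N -> (forall n, A n.-1 -> A n -> A n.+1) -> forall n, A n.
Proof.
move=> A0 AS n; suff : A n /\ A n.-1 by case.
by elim: n => [|n [IH1 IH2]]; split => //; apply: AS.
Qed.

Lemma jcoord_expand f : f = \sum_(k < size f) jcoord k f *: Q k.
Proof.
suff H N : (size f <= N)%N -> f = \sum_(k < N.+1) jcoord k f *: Q k.
  rewrite {1}(H (size f) (leqnn _)) big_ord_recr/= jcoord_size//.
  by rewrite scale0r addr0.
elim/poly_ind: f N => [|f x IH] N.
  by move=> _; rewrite big1// => k _; rewrite jcoord_zero scale0r.
move=> sN; have fN : (size f <= N.-1)%N.
  move: sN; rewrite size_MXaddC; case: eqP => [->|_] /=; last by case: N.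
  by rewrite size_poly0.
have zE (S A B C D : {poly F}) : S + A - B + (C + B) = S + (A + D) + C - D.
  by rewrite [C + B]addrC addrA subrK (addrA S A D) (addrAC _ D C) addrK.
(* Truncation leaves two boundary terms. Once [size f <= M.+1], the first is the missing summand of
   index [M.+1] and the second vanishes. *)
have K M : 'X * (\sum_(k < M.+1) jcoord k f *: Q k) =
    \sum_(k < M.+1) jcoord k ('X * f) *: Q k + (a M * jcoord M f) *: Q M.+1
    - (c M.+1 * jcoord M.+1 f) *: Q M.
  elim: M => [|M IHM].
    rewrite !big_ord1 -scalerAr QX c0 jcoordX0 scale0r addr0 scalerA.
    rewrite [_ * a 0%N]mulrC.
    by rewrite addrAC subrr add0r.
  rewrite big_ord_recr [in RHS]big_ord_recr /= mulrDr IHM jcoordXS.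
  rewrite -scalerAr QX /=.
  rewrite scalerDl scalerDr !scalerA ![jcoord M.+1 f * _]mulrC.
  exact: zE.
have E : \sum_(k < N.+1) jcoord k (f * 'X + x%:P) *: Q k =
  \sum_(k < N.+1) jcoord k ('X * f) *: Q k + x%:P.
  under eq_bigr do rewrite jcoordD scalerDl.
  rewrite big_split/= mulrC; congr (_ + _).
  rewrite big_ord_recl big1 ?addr0 => [|i _];
    rewrite jcoordC /= ?mulr0 ?scale0r//.
  by rewrite mulr1 Q0 alg_polyC.
rewrite E; congr (_ + _).
case: N fN {sN E} => [|N] /= fN.
  have -> : f = 0 by apply/eqP; rewrite -size_poly_leq0.
  by rewrite mul0r mulr0 big1// => k _; rewrite jcoord_zero scale0r.
have {1}-> := IH N fN; rewrite mulrC K [in RHS]big_ord_recr/= jcoordXS.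
have jf0 k : (N < k)%N -> jcoord k f = 0.
  by move=> Nk; rewrite jcoord_size// (leq_trans fN)// ltnW.
by rewrite (jf0 N.+1)// (jf0 N.+2)// !mulr0 addr0 scale0r subr0.
Qed.

Lemma jcoord_basis k n : jcoord k (Q n) = (k == n)%:R.
Proof.
elim/jacobi_ind: n k => [|n IH1 IH2] k; first by rewrite Q0 jcoord1.
have -> : Q n.+1 = (a n)^-1 *: ('X * Q n - c n *: Q n.-1).
  by rewrite QX addrK scalerA mulVf ?scale1r.
rewrite jcoordZ jcoordB jcoordZ IH1.
apply: (canLR (mulKf (a_neq0 n))).
case: k => [|k].
  rewrite jcoordX0 IH2 mulr0; case: n {IH1 IH2} => [|n] /=.
    by rewrite c0 mulr0 mul0r subrr.
  by case: n => [|n]; rewrite /= ?mulr1 ?mulr0 subrr.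
rewrite jcoordXS !IH2 eqSS; case: n {IH1 IH2} => [|n] /=.
  by rewrite c0 mul0r subr0 mulr0 addr0; case: k => //= k; rewrite !mulr0.
rewrite !eqSS; have [<-|_] := eqVneq k.+1 n; last first.
  by rewrite !mulr0 subr0 addr0; case: eqVneq => [->|_]; rewrite ?mulr0.
by rewrite addrK ltn_eqF ?mulr0// ltnW.
Qed.

(** Squared norm of [Q k] for the integral [jcoord 0]; for the polynomials [P] it is [1 / h(k)]. *)
Fixpoint jnorm (k : nat) : F :=
  if k is k'.+1 then jnorm k' * c k / a k' else 1.

(** By induction on [k], the recurrence moves the factor ['X] from [Q k] onto [f], where [jcoordX0]
    and [jcoordXS] apply. *)
Lemma jcoord0M k f : jcoord 0%N (f * Q k) = jnorm k * jcoord k f.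
Proof.
elim/jacobi_ind: k f => [|k IH1 IH2] f; first by rewrite Q0 mulr1 mul1r.
have -> : Q k.+1 = (a k)^-1 *: ('X * Q k - c k *: Q k.-1).
  by rewrite QX addrK scalerA mulVf ?scale1r.
rewrite -scalerAr mulrBr mulrCA mulrA jcoordZ jcoordB -scalerAr jcoordZ IH1 IH2.
case: k {IH1 IH2} => [|k] /=.
  by rewrite c0 mul0r subr0 jcoordX0; field.
by rewrite jcoordXS; field; rewrite !a_neq0.
Qed.

Lemma jcoord0_ortho m n : jcoord 0%N (Q m * Q n) = jnorm n * (m == n)%:R.
Proof. by rewrite jcoord0M jcoord_basis eq_sym. Qed.

Lemma jcoord0_square f :
  jcoord 0%N (f * f) = \sum_(k < size f) jnorm k * jcoord k f ^+ 2.
Proof.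
rewrite {2}(jcoord_expand f) mulr_sumr jcoord_sum.
by apply: eq_bigr => k _; rewrite -scalerAr jcoordZ jcoord0M; ring.
Qed.

End JacobiFunctional.

(** * Chebyshev polynomials on [-2b, 2b] and the arcsine integral *)

Section Chebyshev.
Context {R : realFieldType} (b : R).
Hypothesis b_gt0 : 0 < b.

(** The entry at [0] is doubled because x T_0 = 2b T_1, while x T_k = b (T_(k+1) + T_(k-1)) for k >
    0, at argument x / 2b. *)
Definition cheb_a (k : nat) : R := if k is 0%N then 2 * b else b.
Definition cheb_c (k : nat) : R := if k is 0%N then 0 else b.
Definition tcoord : nat -> {poly R} -> R := jcoord cheb_a cheb_c.

Lemma cheb_a_neq0 n : cheb_a n != 0.
Proof. by case: n => [|n]; rewrite /cheb_a ?mulf_neq0 ?pnatr_eq0 ?gt_eqF. Qed.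

Lemma cheb_norm k : jnorm cheb_a cheb_c k.+1 = 2^-1.
Proof.
elim: k => [|k IH] /=; first by field; rewrite gt_eqF.
by rewrite -[LHS]/(jnorm cheb_a cheb_c k.+1 * b / b) IH mulfK ?gt_eqF.
Qed.

(* These hypotheses make [tau k] the Chebyshev polynomial [T_k(x / 2b)]. *)
Context (tau : nat -> {poly R}).
Hypothesis tau0 : tau 0%N = 1.
Hypothesis tauX :
  forall n, 'X * tau n = cheb_a n *: tau n.+1 + cheb_c n *: tau n.-1.

Lemma horner_tau0 x : (tau 0).[x] = 1.
Proof. by rewrite tau0 hornerC. Qed.

Lemma horner_tau1 x : (tau 1).[x] = x / (2 * b).
Proof.
have /(congr1 (fun p => p.[x])) := tauX 0.
rewrite tau0 scale0r addr0 mulr1 hornerX hornerZ /= => E.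
apply: (canRL (mulfK _)); first by rewrite mulf_neq0 ?pnatr_eq0 ?gt_eqF.
by rewrite mulrC -E.
Qed.

Lemma horner_tauSS k x :
  (tau k.+2).[x] = 2 * (x / (2 * b)) * (tau k.+1).[x] - (tau k).[x].
Proof.
have /(congr1 (fun p => p.[x])) := tauX k.+1.
rewrite mulrC hornerMX hornerD !hornerZ /= => E.
have b0 : b != 0 by rewrite gt_eqF.
apply: (mulfI b0); rewrite -[b * (tau k.+2).[x]](addrK (b * (tau k).[x])) -E.
by field.
Qed.

Lemma norm_tau_le1 k x : `|x| <= 2 * b -> `|(tau k).[x]| <= 1.
Proof.
move=> xb; set y := x / (2 * b).
have y1 : `|y| <= 1.
  have b2 : 0 < 2 * b by rewrite mulr_gt0.
  by rewrite /y normrM normfV (gtr0_norm b2) ler_pdivrMr// mul1r.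
have {}y1 : y ^+ 2 <= 1 by rewrite -[_ ^+ 2]real_normK ?num_real// exprn_ile1.
(* A quadratic form conserved by the recurrence replaces the substitution y = cos t. *)
have inv n : (tau n.+1).[x] ^+ 2 + (tau n).[x] ^+ 2
             - 2 * y * (tau n).[x] * (tau n.+1).[x] = 1 - y ^+ 2.
  elim: n => [|n IH]; first by rewrite horner_tau0 horner_tau1 -/y; ring.
  by rewrite -IH horner_tauSS -/y; ring.
suff : (tau k).[x] ^+ 2 <= 1.
  by rewrite -[_ ^+ 2]real_normK ?num_real// expr_le1.
(* At y = 1 or y = -1 the form is degenerate and bounds nothing, but there T_k = y^k. *)
have [y1'|] := ltP (y ^+ 2) 1; last first.
  move=> y2; have {y1 y2} y1 : y ^+ 2 = 1 by apply/le_anti/andP.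
  suff [] : (tau k).[x] ^+ 2 = 1 /\ (tau k.+1).[x] = y * (tau k).[x].
    by move=> ->.
  elim: k => [|k [IH1 IH2]].
    by rewrite horner_tau0 horner_tau1 -/y expr1n mulr1.
  split; first by rewrite IH2 exprMn y1 IH1 mulr1.
  rewrite horner_tauSS -/y IH2.
  apply/eqP; rewrite -subr_eq0; set t := (tau k).[x].
  have -> : 2 * y * (y * t) - t - y * (y * t) = (y ^+ 2 - 1) * t by ring.
  by rewrite y1 subrr mul0r.
have := inv k; set u := (tau k).[x]; set v := (tau k.+1).[x] => uv.
(* Completing the square, the conserved form is (v - y u)^2 + (1 - y^2) u^2. *)
have D : (1 - y ^+ 2) * u ^+ 2 <= 1 - y ^+ 2.
  rewrite -[X in _ <= X]uv -subr_ge0.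
  have -> : v ^+ 2 + u ^+ 2 - 2 * y * u * v - (1 - y ^+ 2) * u ^+ 2
    = (v - y * u) ^+ 2 by ring.
  exact: sqr_ge0.
by rewrite -(ler_pM2l (_ : 0 < 1 - y ^+ 2)) ?subr_gt0// mulr1.
Qed.

Lemma tau_ge1 k x : 2 * b <= x -> 1 <= (tau k).[x].
Proof.
move=> xb; suff [] : 1 <= (tau k).[x] /\ (tau k).[x] <= (tau k.+1).[x] by [].
have y1 : 1 <= x / (2 * b) by rewrite ler_pdivlMr ?mulr_gt0// mul1r.
elim: k => [|k [IH1 IH2]]; first by rewrite horner_tau0 horner_tau1.
split; first exact: le_trans IH2.
rewrite horner_tauSS; set y := x / _ in y1 *; nra.
Qed.

Lemma tcoord_horner f x :
  f.[x] = \sum_(k < size f) tcoord k f * (tau k).[x].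
Proof.
rewrite {1}(@jcoord_expand _ cheb_a cheb_c tau erefl tau0 tauX f).
by rewrite horner_sum; apply: eq_bigr => k _; rewrite hornerZ.
Qed.

Lemma tcoord0_square_le f (z : R) : 2 * b <= 1 -> (forall k, 0 <= tcoord k f) ->
  f.[1] = 1 -> `|z| <= 2 * b -> f.[z] <= 0 -> tcoord 0 (f * f) <= 2^-1.
Proof.
move=> b1 E_ge0 f1 zb fz.
have [n sf] : exists n, size f = n.+1.
  exists (size f).-1; rewrite prednK// lt0n size_poly_eq0.
  apply/eqP => f0; move: f1; rewrite f0 horner0 => /eqP.
  by rewrite eq_sym oner_eq0.
set E0 := tcoord 0 f; set T := \sum_(k < n) tcoord k.+1 f.
have T0 : 0 <= T by apply: sumr_ge0.
have ET1 : E0 + T <= 1.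
  rewrite -f1 tcoord_horner sf big_ord_recl horner_tau0 mulr1 lerD2l.
  by apply: ler_sum => k _; rewrite ler_peMr ?E_ge0// tau_ge1.
(* At [z] every Chebyshev value is at least -1, so f(z) >= E0 - T. *)
have E0T : E0 <= T.
  move: fz; rewrite tcoord_horner sf big_ord_recl horner_tau0 mulr1.
  rewrite -lerBrDr sub0r => /le_trans; apply; rewrite -sumrN.
  apply: ler_sum => k _; rewrite -mulrN ler_piMr ?E_ge0//.
  by rewrite (le_trans (ler_norm _))// normrN norm_tau_le1.
have -> : tcoord 0 (f * f) = E0 ^+ 2 + 2^-1 * \sum_(k < n) tcoord k.+1 f ^+ 2.
  rewrite /tcoord (jcoord0_square cheb_a_neq0 erefl tau0 tauX).
  rewrite sf big_ord_recl mul1r mulr_sumr; congr (_ + _).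
  by apply: eq_bigr => k _; rewrite cheb_norm.
have TT : \sum_(k < n) tcoord k.+1 f ^+ 2 <= T ^+ 2.
  rewrite expr2 {2}/T mulr_sumr; apply: ler_sum => k _.
  rewrite expr2 ler_wpM2r ?E_ge0//.
  by rewrite /T (bigD1 k)//= lerDl sumr_ge0.
have E00 : 0 <= E0 := E_ge0 0%N.
have H1 : T ^+ 2 <= (1 - E0) ^+ 2 by rewrite ler_sqr ?nnegrE; lra.
(* The two bounds on [E0] and [T] give E0 <= 1/2; then E0^2 + (1 - E0)^2 / 2 = 1/2 - E0 + (3/2) E0^2
   <= 1/2. *)
have H2 : 0 <= E0 * (1 - 2 * E0) by rewrite mulr_ge0//; lra.
rewrite (@le_trans _ _ (E0 ^+ 2 + 2^-1 * (1 - E0) ^+ 2))//.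
  by rewrite lerD2l ler_pM2l ?invr_gt0//; exact: le_trans H1.
nra.
Qed.

End Chebyshev.

(** * Persistence of strict positivity near a point *)

Section PolynomialSign.
Context {R : realType}.

Lemma horner_gt0_nbhs (p : {poly R}) x : 0 < p.[x] ->
  exists2 d, 0 < d & forall y, `|y - x| < d -> 0 < p.[y].
Proof.
move=> px; have /cvgr_gt/(_ _ px) := @continuous_horner R p x.
case/nbhs_ballP => d /= d0 dP; exists d => // y yx; apply: dP.
by rewrite /ball/= distrC.
Qed.

Lemma horner_gt0_nbhs_upto (p : nat -> {poly R}) N x :
  (forall k, (k <= N)%N -> 0 < (p k).[x]) ->
  exists2 d, 0 < d & forall y k, `|y - x| < d -> (k <= N)%N -> 0 < (p k).[y].
Proof.
elim: N => [|N IH] px.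
  have [d d0 dP] := horner_gt0_nbhs (px 0%N (leqnn _)).
  by exists d => // y k yx; rewrite leqn0 => /eqP ->; apply: dP.
have [d d0 dP] := horner_gt0_nbhs (px N.+1 (leqnn _)).
have [e e0 eP] := IH (fun k kN => px k (leqW kN)).
exists (Num.min d e); first by rewrite lt_min d0.
move=> y k; rewrite lt_min => /andP[yd ye]; rewrite leq_eqVlt => /predU1P[->|].
  exact: dP.
exact: eP.
Qed.

End PolynomialSign.

(** * Consequences of nonnegative linearization for the sequence [P] *)

Section RandomWalkPolynomials.
Context {R : realType} (a c : nat -> R) (P : nat -> {poly R}).
Context (g : nat -> nat -> nat -> R).
Hypothesis a_gt0 : forall n, 0 < a n.
Hypothesis c_gt0 : forall n, 0 < c n.+1.
Hypothesis c0 : c 0%N = 0.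
Hypothesis acE : forall n, a n + c n = 1.
Hypothesis P0 : P 0%N = 1.
Hypothesis PX : forall n, 'X * P n = a n *: P n.+1 + c n *: P n.-1.
Hypothesis hg : linearization_coefficients P g.
Hypothesis g_ge0 : forall m n k, 0 <= g m n k.

Local Notation I := (jcoord a c 0%N).
Local Notation s := (jnorm a c).

Let a_neq0 n : a n != 0. Proof. by rewrite gt_eqF. Qed.

Lemma jnorm_gt0 n : 0 < s n.
Proof. by elim: n => //= n IH; rewrite divr_gt0// mulr_gt0. Qed.

Lemma jcoord_linearization m n k : jcoord a c k (P m * P n) = g m n k.
Proof.
have [-> g0] := hg m n.
rewrite jcoord_sum big_mkord.
under eq_bigr do rewrite jcoordZ (jcoord_basis a_neq0 c0 P0 PX).
have [kmn|kmn] := leqP k (m + n); last first.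
  rewrite g0// big1// => i _; rewrite (@gtn_eqF i k) ?mulr0//.
  exact: leq_trans (ltn_ord i) kmn.
have kmn' : (k < (m + n).+1)%N by [].
rewrite (bigD1 (Ordinal kmn'))//= eqxx mulr1 big1 ?addr0// => i ik.
have [ki|] := eqVneq k (i : nat); last by rewrite mulr0.
by move: ik; rewrite -val_eqE /= -ki eqxx.
Qed.

Lemma linearization_haar n : g n n 0%N = s n.
Proof.
by rewrite -jcoord_linearization (jcoord0_ortho a_neq0 c0 P0 PX) eqxx mulr1.
Qed.

Lemma integral3_ge0 m n k : 0 <= I (P m * P n * P k).
Proof.
rewrite (jcoord0M a_neq0 c0 P0 PX) jcoord_linearization.
by rewrite mulr_ge0// ltW// jnorm_gt0.
Qed.

Lemma horner_PX x n : x * (P n).[x] = a n * (P n.+1).[x] + c n * (P n.-1).[x].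
Proof.
by have /(congr1 (horner^~ x)) := PX n;
  rewrite hornerM hornerX hornerD !hornerZ.
Qed.

Lemma horner_P1 n : (P n).[1] = 1.
Proof.
elim/jacobi_ind: n => [|n IH1 IH2]; first by rewrite P0 hornerC.
have := horner_PX 1 n; rewrite mul1r IH1 IH2 mulr1 => E.
by apply: (mulfI (a_neq0 n)); apply: (addIr (c n)); rewrite -E mulr1 acE.
Qed.

Lemma horner_P_ge1 x n : 1 <= x -> 1 <= (P n).[x].
Proof.
move=> x1; suff [] : 1 <= (P n).[x] /\ (P n).[x] <= (P n.+1).[x] by [].
elim: n => [|n [IH1 IH2]].
  split; first by rewrite P0 hornerC.
  have := horner_PX x 0; have := acE 0.
  by rewrite c0 mul0r !addr0 => ->; rewrite mul1r P0 hornerC mulr1 => <-.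
split; first exact: le_trans IH2.
rewrite -(ler_pM2l (a_gt0 n.+1)); have := horner_PX x n.+1 => /=.
set p := (P n).[x] in IH1 IH2 *; set q := (P n.+1).[x] in IH2 *.
set r := (P n.+2).[x] => E.
have -> : a n.+1 * r = x * q - c n.+1 * p by rewrite E addrK.
have -> : a n.+1 = 1 - c n.+1 by rewrite -(acE n.+1) addrK.
have H1 : 0 <= c n.+1 * (q - p) by rewrite mulr_ge0 ?subr_ge0// ltW.
have H2 : 0 <= (x - 1) * q.
  by rewrite mulr_ge0 ?subr_ge0 ?(le_trans _ IH2)// (le_trans _ IH1).
lra.
Qed.

(** Every term of the linearization of P_n^2 is nonnegative at such an [x]; the bound keeps only the
    one of index 0. *)
Lemma horner_P_square_ge x n :
  (forall k, 0 <= (P k).[x]) -> s n <= (P n).[x] ^+ 2.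
Proof.
move=> Px; rewrite expr2 -hornerM (hg n n).1 horner_sum.
rewrite big_nat_recl// hornerZ P0 hornerC mulr1 linearization_haar lerDl.
by apply: sumr_ge0 => k _; rewrite hornerZ mulr_ge0.
Qed.

(** P_2 is a positive multiple of X^2 - c_1, so a nonnegative integral of P_(n+1)^2 P_2 says that
    c_1 times the squared norm of P_(n+1) is at most that of X P_(n+1), which the recurrence and
    orthogonality evaluate. *)
Lemma c1_le n : c 1%N <= a n.+1 * c n.+2 + c n.+1 * a n.
Proof.
have := integral3_ge0 n.+1 n.+1 2.
have E : P 2 = (a 1%N)^-1 *: ('X * P 1%N - c 1%N *: P 0%N).
  by rewrite PX addrK scalerA mulVf ?scale1r.
have P1 : P 1%N = 'X.
  have := PX 0; have := acE 0.
  by rewrite c0 addr0 => ->; rewrite scale0r scale1r addr0 P0 mulr1.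
rewrite E P1 P0 -scalerAr jcoordZ pmulr_rge0 ?invr_gt0//.
have -> : P n.+1 * P n.+1 * ('X * 'X - c 1%N *: 1) =
  ('X * P n.+1) * ('X * P n.+1) - c 1%N *: (P n.+1 * P n.+1).
  by rewrite mulrBr -scalerAr mulr1; congr (_ - _); ring.
rewrite PX /= jcoordB jcoordZ mulrDl !mulrDr -!scalerAl -!scalerAr.
rewrite !jcoordD !jcoordZ !(jcoord0_ortho a_neq0 c0 P0 PX) !eqxx.
rewrite [n == _]ltn_eqF// [_ == n]gtn_eqF// !mulr0 addr0 add0r !mulr1 /=.
rewrite subr_ge0 [s n * c n.+1 / a n * _]mulrC.
have sn := jnorm_gt0 n; have an := a_gt0 n; have an1 := a_gt0 n.+1.
have cn := c_gt0 n.
have -> : a n.+1 * (a n.+1 * (c n.+2 * (s n * c n.+1 / a n) / a n.+1)) +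
   c n.+1 * (c n.+1 * s n) =
   (a n.+1 * c n.+2 + c n.+1 * a n) * (s n * c n.+1 / a n).
  by field; rewrite !gt_eqF.
by rewrite ler_pM2r// divr_gt0// mulr_gt0.
Qed.

(* [onorm] is orthonormal, and [beta n] is its recurrence coefficient between
   the indices [n] and [n.+1]. *)
Definition sigma n : R := Num.sqrt (s n).
Definition beta n : R := Num.sqrt (a n * c n.+1).
Definition onorm n : {poly R} := (sigma n)^-1 *: P n.

Lemma sigma_gt0 n : 0 < sigma n.
Proof. by rewrite sqrtr_gt0 jnorm_gt0. Qed.

Lemma beta_gt0 n : 0 < beta n.
Proof. by rewrite sqrtr_gt0 mulr_gt0. Qed.

(** Since s_(n+1) / s_n = c_(n+1) / a_n, rescaling by [sigma] turns both off-diagonal entries of the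
    Jacobi matrix into [beta n]. *)
Lemma a_sigma n : a n * sigma n.+1 = beta n * sigma n.
Proof.
have an := a_gt0 n; have cn := c_gt0 n; have sn := jnorm_gt0 n.
rewrite -[a n in LHS]ger0_norm ?ltW// -sqrtr_sqr -sqrtrM ?sqr_ge0//.
rewrite -sqrtrM ?mulr_ge0 ?ltW//; congr Num.sqrt => /=.
by field; rewrite gt_eqF.
Qed.

Lemma c_sigma n : c n.+1 * sigma n = beta n * sigma n.+1.
Proof.
have an := a_gt0 n; have cn := c_gt0 n; have sn := jnorm_gt0 n.
rewrite -[c n.+1 in LHS]ger0_norm ?ltW// -sqrtr_sqr -sqrtrM ?sqr_ge0//.
rewrite -sqrtrM ?mulr_ge0 ?ltW//; congr Num.sqrt => /=.
by field; rewrite gt_eqF.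
Qed.

Lemma onormX0 : 'X * onorm 0 = beta 0 *: onorm 1.
Proof.
have s0 n : sigma n != 0 by rewrite gt_eqF ?sigma_gt0.
rewrite /onorm -scalerAr PX c0 scale0r addr0 !scalerA; congr (_ *: _).
apply: (mulfI (s0 0%N)); apply: (mulIf (s0 1%N)).
rewrite mulrA mulfV ?mul1r// a_sigma.
by rewrite mulrA (mulfVK (s0 1%N)) mulrC.
Qed.

Lemma onormXS n :
  'X * onorm n.+1 = beta n.+1 *: onorm n.+2 + beta n *: onorm n.
Proof.
have s0 k : sigma k != 0 by rewrite gt_eqF ?sigma_gt0.
rewrite /onorm -scalerAr PX scalerDr /= !scalerA; congr (_ *: _ + _ *: _).
  apply: (mulfI (s0 n.+1)); apply: (mulIf (s0 n.+2)).
  by rewrite mulVKf// a_sigma mulrA (mulfVK (s0 n.+2)) mulrC.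
apply: (mulfI (s0 n.+1)); apply: (mulIf (s0 n)).
by rewrite mulVKf// c_sigma mulrA (mulfVK (s0 n)) mulrC.
Qed.

Lemma onorm_ortho m n : I (onorm m * onorm n) = (m == n)%:R.
Proof.
rewrite -scalerAl -scalerAr !jcoordZ (jcoord0_ortho a_neq0 c0 P0 PX).
have [->|_] := eqVneq; last by rewrite !mulr0.
rewrite mulr1 mulrA -expr2 exprVn sqr_sqrtr ?ltW ?jnorm_gt0//.
by rewrite mulVf// gt_eqF// jnorm_gt0.
Qed.

Lemma integral_onorm_ge0 n i j : 0 <= I (P n * onorm i * onorm j).
Proof.
rewrite -scalerAr -scalerAr -scalerAl !jcoordZ.
by rewrite !mulr_ge0 ?invr_ge0 ?integral3_ge0// ltW// sigma_gt0.
Qed.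

(** * Nonpositive values on the half-line [0, oo) *)

Lemma horner_P1_0 : (P 1).[0] = 0.
Proof.
have := horner_PX 0 0; rewrite c0 !mul0r addr0 => /esym/eqP.
by rewrite mulf_eq0 (negbTE (a_neq0 0)) => /eqP.
Qed.

Lemma horner_P_succ_neq0 x n : (P n).[x] = 0 -> (P n.+1).[x] = 0 -> False.
Proof.
elim: n => [|n IH] Pn Pn1.
  by move/eqP: Pn; rewrite P0 hornerC oner_eq0.
apply: IH => //; have := horner_PX x n.+1; rewrite Pn Pn1 !mulr0 add0r.
by move=> /esym/eqP; rewrite mulf_eq0 gt_eqF//= => /eqP.
Qed.

(** The point [w] is a supremum over indices in [D], which is later either an initial segment or all
    of the naturals. The set contains 0 because P_1(0) = 0, and [horner_P_ge1] bounds it by 1. *)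
Lemma horner_P_last_nonpos (D : nat -> Prop) : D 1%N ->
  exists w, [/\ 0 <= w, forall k, D k -> 0 <= (P k).[w],
    forall z k, w < z -> D k -> 0 < (P k).[z] &
    forall d, 0 < d ->
      exists y k, [/\ w - d < y, y <= w, D k & (P k).[y] <= 0]].
Proof.
move=> D1; pose S := [set y : R | 0 <= y /\ exists2 k, D k & (P k).[y] <= 0].
have S0 : S 0 by split=> //; exists 1%N; rewrite ?horner_P1_0.
have ubS : ubound S 1.
  move=> y [y0 [k Dk Pk]]; rewrite leNgt; apply/negP => /ltW y1.
  have := horner_P_ge1 k y1.
  by rewrite leNgt (le_lt_trans Pk).
have supS : has_sup S by split; [exists 0 | exists 1].
have w0 : 0 <= sup S by apply: ub_le_sup => //; exists 1.
have Sgt z k : sup S < z -> D k -> 0 < (P k).[z].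
  move=> wz Dk; rewrite ltNge; apply/negP => Pk.
  suff : z <= sup S by rewrite leNgt wz.
  apply: ub_le_sup; first by exists 1.
  by split; [exact: le_trans w0 (ltW wz) | exists k].
exists (sup S); split => //.
  move=> k Dk; rewrite leNgt; apply/negP; rewrite -oppr_gt0 -hornerN => Pk.
  have [d d0 dP] := horner_gt0_nbhs Pk.
  have : 0 < (- P k).[sup S + d / 2].
    by apply: dP; rewrite addrAC subrr add0r gtr0_norm ?divr_gt0//; lra.
  rewrite hornerN oppr_gt0 ltNge ltW// Sgt// ltrDl; lra.
move=> d d0; have [y [y0 [k Dk Pk]] wy] := sup_adherent d0 supS.
exists y, k; split => //; apply: ub_le_sup; first by exists 1.
by split => //; exists k.
Qed.

(** If P_n were positive on [0, oo), some P_k with 0 < k < n would vanish at the last point [w] for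
    indices up to [n]. All these polynomials being nonnegative there, the recurrence makes P_(k-1)
    vanish too, hence, going down, P_0 = 1. *)
Lemma horner_P_nonpos n : (0 < n)%N -> exists2 y, 0 <= y & (P n).[y] <= 0.
Proof.
move=> n0; apply: contrapT => nP.
have Pn y : 0 <= y -> 0 < (P n).[y].
  by move=> y0; rewrite ltNge; apply/negP => Py; apply: nP; exists y.
have [w [w0 Pw _ wS]] := @horner_P_last_nonpos (fun k => (k <= n)%N) n0.
(* Otherwise these finitely many polynomials are positive on a whole neighbourhood of [w], against
   the choice of [w]. *)
have [k kn /eqP Pk] : exists2 k, (k <= n)%N & (P k).[w] == 0.
  apply: contrapT => nk.
  have [|d d0 dP] := @horner_gt0_nbhs_upto R P n w.
    move=> k kn; rewrite lt_neqAle Pw// andbT eq_sym.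
    by apply/negP => Pk; apply: nk; exists k.
  have [y [k [wy yw kn]]] := wS d d0; rewrite leNgt dP//.
  by rewrite ler0_norm ?subr_le0// opprB ltrBlDr addrC -ltrBlDr.
case: k kn Pk => [|k] kn Pk; first by move/eqP: Pk; rewrite P0 hornerC oner_eq0.
have {}kn : (k.+1 < n)%N.
  rewrite ltn_neqAle kn andbT; apply: contraPneq Pk => ->.
  by apply/eqP; rewrite gt_eqF// Pn.
apply: (@horner_P_succ_neq0 w k) => //.
have := horner_PX w k.+1; rewrite Pk mulr0 => /esym/eqP.
rewrite paddr_eq0 ?mulr_ge0 ?Pw ?(ltW (a_gt0 _)) ?(ltW (c_gt0 _))//=;
  last first.
  by rewrite ltnW// ltnW.
by case/andP => _; rewrite mulf_eq0 gt_eqF//= => /eqP.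
Qed.

(** * Comparison with the Chebyshev limit *)

Context (b : R).
Hypothesis b_gt0 : 0 < b.
Hypothesis beta_cvg : beta @ \oo --> b.
Context (tau : nat -> {poly R}).
Hypothesis tau0 : tau 0%N = 1.
Hypothesis tauX :
  forall n, 'X * tau n = cheb_a b n *: tau n.+1 + cheb_c b n *: tau n.-1.

Local Notation U := onorm.

(** Induction on [f]: multiplication by ['X] acts on [U] with entries tending to [b], and on [tau]
    with the limiting entries. *)
Lemma integral_onorm_cvg f j :
  (fun m => I (f * U m * U (j + m)%N)) @ \oo --> tcoord b 0 (f * tau j).
Proof.
have lin h x u y v : I (h * (x *: u + y *: v)) = x * I (h * u) + y * I (h * v).
  by rewrite mulrDr -!scalerAr jcoordD !jcoordZ.
elim/poly_ind: f j => [|f x IH] j.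
  rewrite mul0r /tcoord jcoord_zero.
  by under eq_fun do rewrite !mul0r jcoord_zero; exact: cvg_cst.
have -> : tcoord b 0 ((f * 'X + x%:P) * tau j) =
    tcoord b 0 (f * ('X * tau j)) + x * (j == 0%N)%:R.
  rewrite /tcoord mulrDl jcoordD mulrA mul_polyC jcoordZ.
  rewrite -[in jcoord _ _ _ (tau j)](mulr1 (tau j)) -tau0.
  by rewrite (jcoord0_ortho (cheb_a_neq0 b_gt0) erefl tau0 tauX) mul1r.
have EI m k : I ((f * 'X + x%:P) * U m * U k) =
    I (f * U m * ('X * U k)) + x * (k == m)%:R.
  rewrite -mulrA mulrDl jcoordD mul_polyC jcoordZ.
  rewrite onorm_ortho eq_sym; congr (_ + _).
  by congr (jcoord _ _ _ _); rewrite -!mulrA; congr (_ * _); rewrite mulrCA.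
under eq_fun do rewrite EI.
have -> : (fun m => I (f * U m * ('X * U (j + m)%N)) +
                    x * ((j + m)%N == m)%:R) =
   (fun m => I (f * U m * ('X * U (j + m)%N)) + x * (j == 0%N)%:R).
  by apply/funext => m; rewrite -[X in _ == X]add0n eqn_add2r.
apply: cvgD; last exact: cvg_cst.
have beta_shift n : (fun m => beta (n + m)%N) @ \oo --> b.
  exact: cvg_comp (cvg_addnl n) beta_cvg.
(* For [j = 0] the neighbours m + 1 and m - 1 both give offset 1 by symmetry, whence the factor 2b
   of [cheb_a b 0]. The shift of [m] by one makes m - 1 available. *)
case: j => [|j].
  rewrite tauX /= scale0r addr0 -scalerAr /tcoord jcoordZ -/(tcoord b 0 _).
  rewrite -cvg_shiftS /=.
  have -> : (fun n => I (f * U n.+1 * ('X * U (0 + n.+1)%N))) =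
     (fun n => beta n.+1 * I (f * U n.+1 * U (1 + n.+1)%N) +
               beta n * I (f * U n * U (1 + n)%N)).
    apply/funext => n; rewrite add0n onormXS lin.
    by rewrite (mulrAC f (U n.+1) (U n)).
  have -> t : 2 * b * t = b * t + b * t by ring.
  apply: cvgD; apply: cvgM; rewrite ?(cvg_shiftS beta)//.
  move: (IH 1%N).
  by rewrite -(cvg_shiftS (fun n => I (f * U n * U (1 + n)%N))).
have -> : (fun n => I (f * U n * ('X * U (j.+1 + n)%N))) =
     (fun n => beta (j.+1 + n)%N * I (f * U n * U (j.+2 + n)%N) +
               beta (j + n)%N * I (f * U n * U (j + n)%N)).
  by apply/funext => n; rewrite addSn onormXS lin.
rewrite tauX /= mulrDr -!scalerAr /tcoord jcoordD !jcoordZ -!/(tcoord b 0 _).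
by apply: cvgD; apply: cvgM.
Qed.

Lemma tcoord0M f k :
  tcoord b 0 (f * tau k) = jnorm (cheb_a b) (cheb_c b) k * tcoord b k f.
Proof. exact: (jcoord0M (cheb_a_neq0 b_gt0) erefl tau0 tauX). Qed.

Lemma tcoord_P_ge0 n k : 0 <= tcoord b k (P n).
Proof.
suff : 0 <= tcoord b 0 (P n * tau k).
  rewrite tcoord0M pmulr_rge0//.
  by case: k => [|k]; rewrite ?(cheb_norm b_gt0) ?invr_gt0.
apply: (cvgr_to_ge (@integral_onorm_cvg (P n) k)).
by apply: nearW => m; exact: integral_onorm_ge0.
Qed.

(** * Locating the last nonpositive point inside [0, 2b] *)

Lemma horner_onormXS x n :
  x * (U n.+1).[x] = beta n.+1 * (U n.+2).[x] + beta n * (U n).[x].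
Proof.
have /(congr1 (horner^~ x)) := onormXS n.
by rewrite hornerM hornerX hornerD !(hornerZ (beta _)).
Qed.

Lemma horner_onorm_gt0 x n : (0 < (U n).[x]) = (0 < (P n).[x]).
Proof. by rewrite hornerZ pmulr_rgt0// invr_gt0 sigma_gt0. Qed.

(** With [beta] below some B < w / 2, each step adds at least w / B - 2 > 0 to the increment
    U_(k+1)(w) - U_k(w), as the values are at least 1; the increment thus becomes positive. *)
Lemma onorm_growth w : 2 * b < w -> (forall k, 1 <= (U k).[w]) ->
  exists B K, [/\ 0 < B, 2 * B < w, forall k, (K <= k)%N -> beta k < B &
    (U K).[w] < (U K.+1).[w]].
Proof.
move=> bw Uw; pose B := (b + w / 2) / 2.
have bB : b < B by rewrite /B; lra.
have Bw : 2 * B < w by rewrite /B; lra.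
have B0 : 0 < B by exact: lt_trans bB.
have [K _ KP] := cvgr_lt _ beta_cvg _ bB.
pose e := w / B - 2; have e0 : 0 < e by rewrite subr_gt0 ltr_pdivlMr.
pose d k := (U k.+1).[w] - (U k).[w].
have dS k : (K <= k)%N -> d k + e <= d k.+1.
  move=> Kk; have := horner_onormXS w k.
  have := KP _ Kk; have := KP _ (leqW Kk); rewrite /d /=.
  have := Uw k; have := Uw k.+1; have := Uw k.+2.
  set u := (U k).[w]; set v := (U k.+1).[w]; set t := (U k.+2).[w].
  move=> t1 v1 u1 b1 b2 E.
  have H : w * v <= B * (t + u).
    rewrite E mulrDr lerD// ler_wpM2r ?(ltW b1) ?(ltW b2)//.
      exact: le_trans t1.
    exact: le_trans u1.
  have {}H : w / B * v <= t + u by rewrite mulrAC ler_pdivrMr// [_ * B]mulrC.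
  have : e <= e * v by rewrite ler_peMr// ltW.
  by rewrite /e mulrBl; lra.
have dK i : d K + e * i%:R <= d (K + i)%N.
  elim: i => [|i IH]; first by rewrite mulr0 addr0 addn0.
  rewrite addnS; apply: le_trans (dS _ (leq_addr _ _)).
  by rewrite -natr1 mulrDr mulr1 addrA lerD2r.
pose i := Num.bound `|- d K / e|.
exists B, (K + i)%N; split => //.
  by move=> k Kk; apply: KP; rewrite /= (leq_trans _ Kk)// leq_addr.
rewrite -subr_gt0; apply: lt_le_trans (dK i).
have : - d K / e < i%:R.
  exact: le_lt_trans (ler_norm _) (archi_boundP (normr_ge0 _)).
by rewrite ltr_pdivrMr// -subr_gt0 opprK addrC mulrC.
Qed.

Lemma last_nonpos_le w :
  (forall k, 0 <= (P k).[w]) ->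
  (forall d, 0 < d -> exists y k, [/\ w - d < y, y <= w & (P k).[y] <= 0]) ->
  w <= 2 * b.
Proof.
move=> Pw wS; rewrite leNgt; apply/negP => bw.
have Uw k : 1 <= (U k).[w].
  rewrite hornerZ mulrC ler_pdivlMr ?sigma_gt0// mul1r.
  rewrite -ler_sqr ?nnegrE ?sqrtr_ge0// (sqr_sqrtr (ltW (jnorm_gt0 k))).
  exact: (horner_P_square_ge).
have [B [K [B0 Bw KB UK]]] := onorm_growth bw Uw.
have [|d1 d10 d1P] := @horner_gt0_nbhs_upto R P K.+1 w.
  by move=> k _; rewrite -horner_onorm_gt0 (lt_le_trans ltr01).
have [d2 d20 d2P] : exists2 d, 0 < d &
    forall y, `|y - w| < d -> 0 < (U K.+1 - U K).[y].
  by apply: horner_gt0_nbhs; rewrite hornerD hornerN subr_gt0.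
(* The three bounds keep P_k(y) > 0 for k <= K + 1, U_K(y) < U_(K+1)(y), and y > 2B. *)
have d0 : 0 < Num.min (Num.min d1 d2) (w - 2 * B).
  by rewrite !lt_min d10 d20 subr_gt0.
have [y [k [wy yw]]] := wS _ d0; rewrite leNgt; apply/negP; rewrite negbK.
have : w - y < Num.min (Num.min d1 d2) (w - 2 * B).
  by rewrite ltrBlDr addrC -ltrBlDr.
rewrite !lt_min -andbA => /and3P[yd1 yd2 yB].
have nyw : `|y - w| = w - y by rewrite distrC ger0_norm// subr_ge0.
have {}d2P := d2P y; have {}d1P k := d1P y k.
rewrite nyw in d1P d2P.
have {}yB : 2 * B < y by move: yB; rewrite ltrD2l ltrN2.
have [kK|Kk] := leqP k K.+1; first exact: d1P.
rewrite -(subnKC (ltnW (ltnW Kk))) -horner_onorm_gt0.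
suff [] : 0 < (U (K + (k - K))%N).[y] /\
  (U (K + (k - K))%N).[y] <= (U (K + (k - K)).+1).[y] by [].
(* Growth propagates at [y]: if 0 < u <= v, then B t >= y v - B v >= B v, so t >= v. *)
elim: (k - K)%N => [|i [IH1 IH2]].
  rewrite addn0 horner_onorm_gt0 d1P//; split => //.
  by rewrite -subr_ge0 -hornerN -hornerD ltW// d2P.
rewrite addnS; set j := (K + i)%N in IH1 IH2 *.
have U1 : 0 < (U j.+1).[y] by exact: lt_le_trans IH2.
split=> //; have := horner_onormXS y j.
have := KB j (leq_addr _ _); have := KB j.+1 (leqW (leq_addr _ _)).
have := beta_gt0 j.+1.
set u := (U j).[y] in IH1 IH2 *; set v := (U j.+1).[y] in IH2 U1 *.
set t := (U j.+2).[y] => b0 b1 b2 E.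
have H1 : 2 * B * v <= y * v by rewrite ler_pM2r// ltW.
have H2 : beta j * u <= B * v by rewrite ler_pM// ltW// beta_gt0.
have t0 : 0 < t.
  by rewrite -(pmulr_rgt0 _ b0) -[_ * t](addrK (beta j * u)) -E subr_gt0; nra.
have H3 : beta j.+1 * t <= B * t by rewrite ler_pM2r// ltW.
by rewrite -(ler_pM2l B0); lra.
Qed.

Lemma horner_P_nonpos_le n : (0 < n)%N ->
  exists2 y, `|y| <= 2 * b & (P n).[y] <= 0.
Proof.
move=> n0; have [y y0 Py] := horner_P_nonpos n0; exists y => //.
have [w [w0 Pw wP wS]] := @horner_P_last_nonpos (fun=> True) Logic.I.
rewrite ger0_norm// (@le_trans _ _ w)//.
  rewrite leNgt; apply/negP => wy.
  by move: (wP _ n wy Logic.I); rewrite ltNge Py.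
apply: last_nonpos_le => [k|d d0]; first exact: Pw.
by have [z [k [wz zw _ Pz]]] := wS d d0; exists z, k.
Qed.

(** Integrating the linearization of P_n^2 against the arcsine measure gives [g n n 0] plus terms
    that are nonnegative by [tcoord_P_ge0]. *)
Lemma linearization0_le n : 2 * b <= 1 -> (0 < n)%N -> g n n 0%N <= 2^-1.
Proof.
move=> b1 n0; have [y yb Py] := horner_P_nonpos_le n0.
apply: le_trans (tcoord0_square_le b_gt0 tau0 tauX b1 (tcoord_P_ge0 n)
  (horner_P1 n) yb Py).
rewrite (hg n n).1 /tcoord jcoord_sum big_nat_recl//.
rewrite jcoordZ P0 jcoord1 mulr1 lerDl.
by apply: sumr_ge0 => k _; rewrite jcoordZ mulr_ge0// tcoord_P_ge0.
Qed.

End RandomWalkPolynomials.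

Theorem corollary2p4 (R : realType) (c : nat -> R) (P : nat -> {poly R})
    (g : nat -> nat -> nat -> R)
    (hc : forall n : nat, (1 <= n)%N -> 0 < c n < 1)
    (hP : three_term_recurrence c P)
    (hg : linearization_coefficients P g)
    (g_ge0 : forall m n k : nat, 0 <= g m n k)
    (c_cvg : cvgn c) :
  forall n : nat, (1 <= n)%N -> 2 <= haar g n.
Proof.
move=> n n0; have [P0 P1 PX] := hP.
(* The paper's convention a_0 = 1, together with c_0 = 0, extends the
   recurrence to index 0. *)
pose c' k := if k is 0%N then 0 else c k; pose a k := 1 - c' k.
have a_gt0 k : 0 < a k.
  by case: k => [|k]; rewrite /a /= ?subr0// subr_gt0; case/andP: (hc k.+1 isT).
have c_gt0 k : 0 < c' k.+1 by case/andP: (hc k.+1 isT).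
have acE k : a k + c' k = 1 by rewrite subrK.
have PX' k : 'X * P k = a k *: P k.+1 + c' k *: P k.-1.
  case: k => [|k]; last exact: PX.
  by rewrite /a /= P0 P1 subr0 scale1r scale0r addr0 mulr1.
pose l := limn c; have cS i : (fun k => c (i + k)%N) @ \oo --> l.
  exact: cvg_comp (cvg_addnl i) c_cvg.
have acS i j : (fun k => (1 - c (i + k)%N) * c (j + k)%N) @ \oo --> (1 - l) * l.
  by apply: cvgM => //; apply: cvgB => //; apply: cvg_cst.
pose b := Num.sqrt ((1 - l) * l).
(* The limit of [c1_le] is c_1 <= 2 l (1 - l), and c_1 > 0. Indices start at 1 so that [c'] reduces
   to [c]. *)
have b_gt0 : 0 < b.
  have : c 1%N <= (1 - l) * l + (1 - l) * l.
    apply: (cvgr_to_ge (cvgD (acS 2%N 3%N) (acS 1%N 2%N))).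
    apply: nearW => m.
    have := c1_le a_gt0 c_gt0 erefl acE P0 PX' hg g_ge0 m.+1.
    by rewrite [c' m.+2 * _]mulrC.
  by have /andP[] := hc 1%N isT; rewrite sqrtr_gt0; lra.
have beta_cvg : beta a c' @ \oo --> b.
  rewrite -cvg_shiftS.
  exact: (continuous_cvg _ (@sqrt_continuous _ _) (acS 1%N 2%N)).
(* This is 4 l (1 - l) <= 1; it places the point 1 to the right of [-2b, 2b] or at its end. *)
have b1 : 2 * b <= 1.
  rewrite -ler_sqr ?nnegrE ?mulr_ge0 ?sqrtr_ge0// exprMn sqr_sqrtr; last first.
    by rewrite ltW// -sqrtr_gt0.
  by have := sqr_ge0 (2 * l - 1); lra.
have gn := linearization0_le a_gt0 c_gt0 erefl acE P0 PX' hg g_ge0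
  b_gt0 beta_cvg (erefl : jpoly (cheb_a b) (cheb_c b) 0 = 1)
  (fun k => jpolyX (cheb_a_neq0 b_gt0 k) erefl) b1 n0.
have gn0 : 0 < g n n 0%N.
  by rewrite (linearization_haar a_gt0 erefl P0 PX' hg) jnorm_gt0.
by rewrite /haar ler_pdivlMr//; lra.
Qed.
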